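(* Let $\Omega\subset\mathbb{R}^N$, $N\ge 2$, be a strictly convex bounded domain and let $g:\partial\Omega\to\mathbb{R}$ be continuous. Then the family of $\alpha$-convex envelopes $\{u^*_\alpha\}_{\alpha\in[0,1]}$ of $g$ is equicontinuous in $\overline{\Omega}$.
   Context: $\Omega$ is strictly convex if $tx+(1-t)y\in\Omega$ for every $x,y\in\overline{\Omega}$, $x\ne y$, and $t\in(0,1)$. For $\alpha\in[0,1]$, $L_\alpha(v)(t)=\alpha v''(t)+(1-\alpha)|v'(t)|^2$. A function $u:\overline{\Omega}\to\mathbb{R}$ is $\alpha$-convex if for any $x,y\in\overline{\Omega}$ one has $u(tx+(1-t)y)\le v(t)$ for all $t\in(0,1)$, where $v$ is the solution of $L_\alpha(v)=0$ in $(0,1)$ with $v(0)=u(y)$, $v(1)=u(x)$. For $\alpha\in(0,1]$, $v$ is the unique classical solution; for $\alpha=0$ the solution is understood in the viscosity sense and is $v(t)=\max\{u(x),u(y)\}$ for $t\in(0,1)$, so that $0$-convex means quasiconvex, while $1$-convex means convex. The $\alpha$-convex envelope of $g$ is $$u^*_\alpha(z)=\sup\{v(z): v:\overline{\Omega}\to\mathbb{R}\text{ is }\alpha\text{-convex and } v|_{\partial\Omega}\le g\},\qquad z\in\overline{\Omega}$$ (on $\partial\Omega$ this gives $u^*_\alpha=g$). *)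

(* Defs.v *)
From HB Require Import structures.
From mathcomp Require Import all_boot all_order all_algebra.
From mathcomp Require Import all_classical all_reals all_analysis.

Set Implicit Arguments.
Unset Strict Implicit.
Unset Printing Implicit Defensive.

Import Order.TTheory GRing.Theory Num.Theory.
Import numFieldNormedType.Exports.

Local Open Scope classical_set_scope.
Local Open Scope ring_scope.

Definition frontier (T : topologicalType) (A : set T) : set T :=
  closure A `\` interior A.

Definition is_domain (T : topologicalType) (A : set T) : Prop :=
  [/\ open A, connected A & A !=set0].

Definition strictly_convex (R : realType) (N : nat) (Omega : set 'rV[R]_N) : Prop :=
  forall (x y : 'rV[R]_N) (t : R),
    closure Omega x -> closure Omega y -> x <> y -> 0 < t < 1 ->
    Omega (t *: x + (1 - t) *: y).

Definition L_op (R : realType) (alpha : R) (v : R -> R) (t : R) : R :=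
  alpha * derive1n 2 v t + (1 - alpha) * `|derive1 v t| ^+ 2.

(* C^2(]0,1[) and C([0,1]) solutions of [L_op alpha v = 0] in ]0,1[ *)
Definition classical_solution (R : realType) (alpha a b : R) (v : R -> R) : Prop :=
  [/\ {within `[0, 1], continuous v},
      v 0 = a, v 1 = b &
      forall t : R, 0 < t < 1 ->
        [/\ derivable v t 1, derivable (derive1 v) t 1,
            {for t, continuous (derive1n 2 v)} &
            L_op alpha v t = 0]].

(* For alpha = 0 the equation is |v'|^2 = 0, whose viscosity solution with data
   a and b is constant, equal to the larger datum, inside the interval; the
   endpoint values are kept, so that it may jump at 0 or at 1. *)
Definition quasi_solution (R : realType) (a b : R) (v : R -> R) : Prop :=
  [/\ v 0 = a, v 1 = b & forall t : R, 0 < t < 1 -> v t = Num.max a b].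

Definition is_solution (R : realType) (alpha a b : R) (v : R -> R) : Prop :=
  if alpha == 0 then quasi_solution a b v else classical_solution alpha a b v.

(* Functions on the closure of Omega are represented by total functions of which
   only the values on the closure matter. For alpha in [0, 1] the solution v
   exists and its values on [0, 1] are unique. *)
Definition alpha_convex (R : realType) (N : nat) (Omega : set 'rV[R]_N)
    (alpha : R) (u : 'rV[R]_N -> R) : Prop :=
  forall x y : 'rV[R]_N, closure Omega x -> closure Omega y ->
  forall v : R -> R, is_solution alpha (u y) (u x) v ->
  forall t : R, 0 < t < 1 -> u (t *: x + (1 - t) *: y) <= v t.

Definition alpha_envelope (R : realType) (N : nat) (Omega : set 'rV[R]_N)
    (g : 'rV[R]_N -> R) (alpha : R) (z : 'rV[R]_N) : R :=
  sup [set v z | v in [set v : 'rV[R]_N -> R |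
        alpha_convex Omega alpha v /\
        forall x, frontier Omega x -> v x <= g x]].

(* Main.v *)
Require Import Defs.
From HB Require Import structures.
From mathcomp Require Import all_boot all_order all_algebra.
From mathcomp Require Import all_classical all_reals all_analysis.
From mathcomp Require Import ring lra.

Set Implicit Arguments.
Unset Strict Implicit.
Unset Printing Implicit Defensive.

Import Order.TTheory GRing.Theory Num.Theory.
Import numFieldNormedType.Exports.

Local Open Scope classical_set_scope.
Local Open Scope ring_scope.

(* For 0 < alpha <= 1, u is alpha-convex iff its Hopf-Cole transform exp(k u),
   k = (1 - alpha) / alpha (u itself if alpha = 1), is convex; so every convex
   function is alpha-convex, and every alpha-convex one is quasiconvex.  At a
   boundary point z strict convexity gives a linear functional that is uniquely
   maximal at z.  It yields affine lower barriers, and an upper bound by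
   quasiconvexity along a chord in its level set, whose endpoints are close to
   z: the envelopes are continuous at the boundary, uniformly in alpha.  This
   modulus propagates inside (Walsh): if it is at most e for a translation h,
   then max(u*(x), u*(x + h) - e), extended by u*(x), competes in the
   definition of u*, hence u*(x + h) - e <= u*(x). *)

(** * Means associated with the operators [L_op] *)

Section alpha_mean.
Context {R : realType}.
Implicit Types (alpha a b c t : R) (v : R -> R).

(** With [k = (1 - alpha) / alpha], the equation reads v'' + k v'^2 = 0, so exp(k v) has zero second
    derivative. At [alpha = 1] this exponential would be constant, hence the separate case. *)
Definition hopf_cole alpha c : R :=
  if alpha == 1 then c else expR ((1 - alpha) / alpha * c).

Lemma ler_hopf_cole alpha : 0 < alpha <= 1 ->
  {mono hopf_cole alpha : x y / x <= y}.
Proof.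
move=> /andP[a0 a1] x y; rewrite /hopf_cole; case: eqVneq => // an1.
by rewrite ler_expR ler_pM2l// divr_gt0// subr_gt0 lt_neqAle an1.
Qed.

(** The value at [t] of the solution with data [a] at 0 and [b] at 1. At [alpha = 0] it is the
    maximum even for [t = 0] or [t = 1], so the endpoint facts below are inequalities. *)
Definition alpha_mean alpha t a b : R :=
  if alpha == 0 then Num.max a b
  else if alpha == 1 then (1 - t) * a + t * b
  else ln ((1 - t) * expR ((1 - alpha) / alpha * a) +
           t * expR ((1 - alpha) / alpha * b)) / ((1 - alpha) / alpha).

Lemma conv_gt0 t a b : 0 <= t <= 1 -> 0 < a -> 0 < b ->
  0 < (1 - t) * a + t * b.
Proof.
move=> /andP[t0 t1] a0 b0; have [->|tn1] := eqVneq t 1; first by lra.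
have t1' : t < 1 by rewrite lt_neqAle tn1.
by nra.
Qed.

Lemma hopf_cole_mean alpha t a b : 0 < alpha <= 1 -> 0 <= t <= 1 ->
  hopf_cole alpha (alpha_mean alpha t a b) =
  (1 - t) * hopf_cole alpha a + t * hopf_cole alpha b.
Proof.
move=> /andP[a0 a1] t01; rewrite /hopf_cole /alpha_mean (gt_eqF a0).
case: eqVneq => // an1.
have k0 : 0 < (1 - alpha) / alpha by rewrite divr_gt0// subr_gt0 lt_neqAle an1.
rewrite mulrC divfK ?gt_eqF// lnK// posrE.
by apply: conv_gt0; rewrite ?expR_gt0.
Qed.

Lemma le_alpha_mean alpha t a b c : 0 < alpha <= 1 -> 0 <= t <= 1 ->
  (c <= alpha_mean alpha t a b) =
  (hopf_cole alpha c <= (1 - t) * hopf_cole alpha a + t * hopf_cole alpha b).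
Proof.
by move=> a01 t01; rewrite -hopf_cole_mean// ler_hopf_cole.
Qed.

Lemma alpha_gt0 alpha : 0 <= alpha <= 1 -> alpha = 0 \/ 0 < alpha <= 1.
Proof.
by move=> /andP[]; rewrite le_eqVlt => /orP[/eqP <-|->]; [left|right].
Qed.

Lemma le_alpha_mean2 alpha t a b a' b' : 0 <= alpha <= 1 -> 0 <= t <= 1 ->
  a <= a' -> b <= b' -> alpha_mean alpha t a b <= alpha_mean alpha t a' b'.
Proof.
move=> /alpha_gt0[->|a01] t01 aa bb.
  by rewrite /alpha_mean eqxx ge_max !le_max aa bb orbT.
rewrite le_alpha_mean// hopf_cole_mean//; case/andP: t01 => t0 t1.
by rewrite lerD// ler_wpM2l ?subr_ge0// ler_hopf_cole.
Qed.

Lemma alpha_mean_le_max alpha t a b : 0 <= alpha <= 1 -> 0 <= t <= 1 ->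
  alpha_mean alpha t a b <= Num.max a b.
Proof.
move=> al01 t01.
apply: (@le_trans _ _ (alpha_mean alpha t (Num.max a b) (Num.max a b))).
  by rewrite le_alpha_mean2// le_max lexx ?orbT.
case: (alpha_gt0 al01) => [->|a01]; first by rewrite /alpha_mean eqxx maxxx.
rewrite -(ler_hopf_cole a01) hopf_cole_mean//; lra.
Qed.

(** For [0 < alpha < 1] this is Jensen's inequality for exp, from its tangent line at [k * c]. It
    makes affine functions alpha-convex. *)
Lemma conv_le_alpha_mean alpha t a b : 0 <= alpha <= 1 -> 0 <= t <= 1 ->
  (1 - t) * a + t * b <= alpha_mean alpha t a b.
Proof.
move=> /alpha_gt0[->|a01] /andP[t0 t1].
  rewrite /alpha_mean eqxx; set m := Num.max a b.
  have am : a <= m by rewrite le_max lexx.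
  have bm : b <= m by rewrite le_max lexx orbT.
  nra.
rewrite le_alpha_mean ?t0// /hopf_cole; case: eqVneq => // _.
set k := (1 - alpha) / alpha; set c := _ + t * b.
have -> : k * a = k * c + k * (a - c) by ring.
have -> : k * b = k * c + k * (b - c) by ring.
rewrite !expRD; have := expR_gt0 (k * c); move: (expR (k * c)) => e e0.
have ea := expR_ge1Dx (k * (a - c)); have eb := expR_ge1Dx (k * (b - c)).
have h : 1 <= (1 - t) * expR (k * (a - c)) + t * expR (k * (b - c)).
  apply: (@le_trans _ _ ((1 - t) * (1 + k * (a - c)) + t * (1 + k * (b - c)))).
    by rewrite le_eqVlt; apply/orP; left; apply/eqP; rewrite /c; ring.
  by rewrite lerD// ler_wpM2l// subr_ge0.
nra.
Qed.

(** The exponential turns the shift by [e] into a factor common to both data. *)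
Lemma alpha_meanB alpha t a b e : 0 <= alpha <= 1 -> 0 <= t <= 1 ->
  alpha_mean alpha t a b - e <= alpha_mean alpha t (a - e) (b - e).
Proof.
move=> /alpha_gt0[->|a01] t01.
  rewrite /alpha_mean eqxx.
  by case: (leP a b) => ab; case: (leP (a - e) (b - e)) => abe; lra.
have := hopf_cole_mean a b a01 t01.
rewrite le_alpha_mean//; move: (alpha_mean _ _ _ _) => m.
rewrite /hopf_cole; case: eqVneq => [_ -> |_ h]; first by lra.
by rewrite !mulrBr !expRD h; lra.
Qed.

Lemma alpha_mean0 alpha a b : 0 <= alpha <= 1 -> a <= alpha_mean alpha 0 a b.
Proof.
move=> /alpha_gt0[->|a01]; first by rewrite /alpha_mean eqxx le_max lexx.
by rewrite le_alpha_mean ?lexx//; lra.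
Qed.

Lemma alpha_mean1 alpha a b : 0 <= alpha <= 1 -> b <= alpha_mean alpha 1 a b.
Proof.
move=> /alpha_gt0[->|a01]; first by rewrite /alpha_mean eqxx le_max lexx orbT.
by rewrite le_alpha_mean ?lexx//; lra.
Qed.

(** Transformed means are affine in the parameter, so two means over the same data combine into the
    mean at the interpolated parameter. *)
Lemma alpha_mean_comp alpha a b r s s' : 0 <= alpha <= 1 -> 0 <= r <= 1 ->
  0 <= s <= 1 -> 0 <= s' <= 1 ->
  alpha_mean alpha r (alpha_mean alpha s a b) (alpha_mean alpha s' a b) <=
  alpha_mean alpha ((1 - r) * s + r * s') a b.
Proof.
move=> /alpha_gt0[->|a01] r01 s01 s'01; first by rewrite /alpha_mean eqxx maxxx.
rewrite le_alpha_mean//; last by nra.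
by rewrite !hopf_cole_mean//; lra.
Qed.

(** * Uniqueness and existence of solutions of [L_op alpha v = 0] *)

Lemma is_derive_derive1 v t : derivable v t 1 -> is_derive t 1 v (derive1 v t).
Proof. by move=> dv; apply: DeriveDef => //; rewrite derive1E. Qed.

Lemma is_derive_expRZ k v t d : is_derive t 1 v d ->
  is_derive t 1 (fun s => expR (k * v s)) (expR (k * v t) * (k * d)).
Proof.
move=> dv.
exact: (@is_derive1_comp _ expR (k \*: v) t _ _ (is_derive_expR _)
  (is_deriveZ k dv)).
Qed.

Lemma is_derive_cst_oo (f : R -> R) (x y : R) :
  (forall t, 0 < t < 1 -> is_derive t 1 f 0) ->
  0 < x < 1 -> 0 < y < 1 -> f x = f y.
Proof.
move=> df; wlog xy : x y / x < y.
  move=> h x01 y01; have [xy|yx|-> //] := ltgtP x y; first exact: h.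
  by apply/esym/h.
move=> /andP[x0 x1] /andP[y0 y1].
have dxy s : s \in `[x, y]%R -> is_derive s 1 f 0.
  by rewrite in_itv/= => /andP[xs sy]; apply: df; lra.
have cf : {within `[x, y], continuous f}.
  by apply: derivable_within_continuous => s sxy; have [] := dxy _ sxy.
have dxy' s : s \in `]x, y[%R -> is_derive s 1 f (cst 0 s).
  by move=> sxy; apply: dxy; apply: subset_itv_oo_cc sxy.
have [c _ /= /eqP] := MVT xy dxy' cf.
by rewrite mul0r subr_eq0 eq_sym => /eqP.
Qed.

(* The derivative of [hopf_cole alpha \o v] is a multiple of this quantity *)
Lemma classical_solution_flux alpha a b v : 0 < alpha <= 1 ->
  classical_solution alpha a b v ->
  exists c, forall t, 0 < t < 1 ->
    expR ((1 - alpha) / alpha * v t) * derive1 v t = c.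
Proof.
move=> /andP[a0 a1] [cv v0 v1 hv]; set k := (1 - alpha) / alpha.
pose E t := expR (k * v t) * derive1 v t.
have dE t : 0 < t < 1 -> is_derive t 1 E 0.
  move=> t01; have [dv ddv _ hL] := hv _ t01.
  have h1 : is_derive t 1 v (derive1 v t) := is_derive_derive1 dv.
  have h2 : is_derive t 1 (derive1 v) (derive1 (derive1 v) t) :=
    is_derive_derive1 ddv.
  have := is_deriveM (is_derive_expRZ k h1) h2.
  move=> /is_derive_eq; apply; rewrite /GRing.scale /=.
  have : derive1 (derive1 v) t + k * derive1 v t ^+ 2 = 0.
    move: hL; rewrite /L_op /= real_normK ?num_real// => hL.
    apply: (mulfI (lt0r_neq0 a0)); rewrite mulr0 -hL /k; field.
    by rewrite gt_eqF.
  move=> h; rewrite -[RHS](mulr0 (expR (k * v t))) -h; ring.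
exists (E 2^-1) => t t01.
by apply: (is_derive_cst_oo dE t01); lra.
Qed.

(** By the constant flux the transform [w] has constant derivative on ]0, 1[; continuity up to 0 and
    1 lets the mean value theorem reach the data. *)
Lemma hopf_cole_classical alpha a b v t : 0 < alpha <= 1 ->
  classical_solution alpha a b v -> 0 < t < 1 ->
  hopf_cole alpha (v t) = (1 - t) * hopf_cole alpha a + t * hopf_cole alpha b.
Proof.
move=> a01 hs /andP[t0 t1]; have [c hc] := classical_solution_flux a01 hs.
case: hs => cv v0 v1 hv; set k := (1 - alpha) / alpha in hc.
pose w s := hopf_cole alpha (v s).
(* The chain rule factor: [k] vanishes at [alpha = 1], where the transform is the identity. *)
pose kap : R := if alpha == 1 then 1 else k.
have dw (s : R) : 0 < s < 1 -> is_derive s 1 w (kap * c).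
  move=> s01; have [dv _ _ _] := hv _ s01.
  have h1 : is_derive s 1 v (derive1 v s) := is_derive_derive1 dv.
  rewrite -(hc s s01) /w /hopf_cole /kap /k; case: eqVneq => [->|_].
    by rewrite subrr !mul0r expR0 !mul1r.
  apply: (is_derive_eq (is_derive_expRZ _ h1)); ring.
have cw : {within `[0, 1], continuous w}.
  rewrite /w /hopf_cole; case: eqVneq => // _.
  have ce : continuous (fun y => expR ((1 - alpha) / alpha * y)).
    by move=> y; apply: continuous_comp; [exact: mulrl_continuous|
      exact: continuous_expR].
  by move=> x; exact: (continuous_comp (cv x) (ce (v x))).
have mvt x y : 0 <= x -> y <= 1 -> x < y -> w y - w x = kap * c * (y - x).
  move=> x0 y1 xy.
  have dxy s : s \in `]x, y[%R -> is_derive s 1 w (cst (kap * c) s).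
    by rewrite in_itv/= => /andP[? ?]; apply: dw; lra.
  have cxy : {within `[x, y], continuous w}.
    by apply: continuous_subspaceW cw => s /=; rewrite !in_itv/=; lra.
  by have [] := MVT xy dxy cxy.
have := mvt 0 t (lexx _) (ltW t1) t0.
have := mvt t 1 (ltW t0) (lexx _) t1.
rewrite /w v0 v1 subr0 => e1 e0; apply/eqP; rewrite -subr_eq0; apply/eqP.
set wt := hopf_cole alpha (v t) in e0 e1 *.
set w0 := hopf_cole alpha a in e0 *; set w1 := hopf_cole alpha b in e1 *.
(* The increments over [0, t] and [t, 1] have the same slope, so this weighted difference
   vanishes. *)
transitivity ((1 - t) * (wt - w0) - t * (w1 - wt)); first by ring.
by rewrite e0 e1; ring.
Qed.

Lemma solution_alpha_mean alpha a b v t : 0 <= alpha <= 1 ->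
  is_solution alpha a b v -> 0 < t < 1 -> v t = alpha_mean alpha t a b.
Proof.
rewrite /is_solution; move=> /alpha_gt0[->|a01].
  by rewrite eqxx => -[_ _ h] /h ->; rewrite /alpha_mean eqxx.
rewrite gt_eqF; last by case/andP: a01.
move=> hs t01; apply: (inc_inj (ler_hopf_cole a01)).
rewrite (hopf_cole_classical a01 hs)// hopf_cole_mean//.
by case/andP: t01 => /ltW -> /ltW ->.
Qed.

(** The equation in normal form v'' = - k v'^2; continuity of v'' comes from differentiability of
    [v1]. *)
Lemma classical_solutionI alpha v v1 : 0 < alpha <= 1 ->
  {within `[0, 1], continuous v} ->
  (forall t : R, 0 < t < 1 -> is_derive t 1 v (v1 t)) ->
  (forall t : R, 0 < t < 1 ->
    is_derive t 1 v1 (- ((1 - alpha) / alpha * v1 t ^+ 2))) ->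
  classical_solution alpha (v 0) (v 1) v.
Proof.
move=> /andP[a0 a1] cv dv dv1; split=> // t t01.
have nt (s : R) : 0 < s < 1 -> \forall x \near s, 0 < x < 1.
  move=> s01; have /near_in_itvoo : s \in `]0, 1[%R by rewrite in_itv.
  by apply: filterS => x; rewrite in_itv.
have E1 (s : R) : 0 < s < 1 -> derive1 v s = v1 s.
  by move=> s01; rewrite derive1E; have [_ ->] := dv _ s01.
have nE1 (s : R) : 0 < s < 1 -> \forall x \near s, v1 x = derive1 v x.
  by move=> /nt; apply: filterS => x /E1 ->.
have d2 (s : R) (s01 : 0 < s < 1) := near_eq_is_derive (nE1 s s01) (dv1 s s01).
have E2 (s : R) : 0 < s < 1 ->
    derive1 (derive1 v) s = - ((1 - alpha) / alpha * v1 s ^+ 2).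
  by move=> s01; rewrite derive1E; have [_ ->] := d2 _ s01.
split.
- by have [] := dv _ t01.
- by have [] := d2 _ t01.
- change (derive1 (derive1 v) @ t --> derive1 (derive1 v) t); rewrite E2//.
  have c1 : {for t, continuous (fun s => - ((1 - alpha) / alpha * v1 s ^+ 2))}.
    have [dt _] := dv1 _ t01.
    have c1 : {for t, continuous v1}.
      by apply: differentiable_continuous; apply/derivable1_diffP.
    apply: cvgN; apply: cvgM; first exact: cvg_cst.
    by under eq_fun do rewrite expr2; rewrite expr2; apply: cvgM.
  apply: cvg_trans c1; apply: near_eq_cvg.
  by have := nt _ t01; apply: filterS => s /E2 ->.
- rewrite /L_op -[derive1n 2 v t]/(derive1 (derive1 v) t) E2// E1//.
  rewrite real_normK ?num_real//; field.
  by rewrite gt_eqF.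
Qed.

(** [alpha_convex] quantifies over all solutions, so its inequality has content only once a solution
    exists. *)
Lemma exists_solution alpha a b : 0 <= alpha <= 1 ->
  exists v, is_solution alpha a b v.
Proof.
rewrite /is_solution; move=> /alpha_gt0[->|a01].
  rewrite eqxx; exists (fun t => if t == 0 then a else if t == 1 then b
    else Num.max a b); split=> [||t /andP[t0 t1]].
  - by rewrite eqxx.
  - by rewrite oner_eq0 eqxx.
  - by rewrite gt_eqF// lt_eqF.
have /andP[a0 a1] := a01; rewrite gt_eqF//.
pose k := (1 - alpha) / alpha.
have dA (p q t : R) : is_derive t 1 (fun s => p + s * q) q.
  have h := is_deriveD (is_derive_cst p t 1)
    (is_deriveM (is_derive_id t 1) (is_derive_cst q t 1)).
  by apply: (is_derive_eq h); rewrite /GRing.scale /=; ring.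
have [al1|an1] := eqVneq alpha 1.
  pose v (t : R) := a + t * (b - a).
  have va : v 0 = a by rewrite /v mul0r addr0.
  have vb : v 1 = b by rewrite /v mul1r addrC subrK.
  exists v; rewrite -va -vb.
  apply: (@classical_solutionI _ v (cst (b - a)) a01).
    by apply: derivable_within_continuous => s _; have [] := dA a (b - a) s.
  by move=> t _; rewrite al1 subrr !mul0r oppr0; exact: is_derive_cst.
have k0 : 0 < k by rewrite divr_gt0// subr_gt0 lt_neqAle an1.
pose c := expR (k * b) - expR (k * a).
(* [A] interpolates affinely between the transformed data; inverting the Hopf-Cole transform then
   yields [v]. *)
pose A (t : R) := expR (k * a) + t * c.
have A0 (t : R) : 0 <= t <= 1 -> 0 < A t.
  move=> t01; have := conv_gt0 t01 (expR_gt0 (k * a)) (expR_gt0 (k * b)).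
  by rewrite (_ : _ + _ = A t)// /A /c; ring.
pose v t := ln (A t) / k.
have dv (t : R) : 0 <= t <= 1 -> is_derive t 1 v (c / (k * A t)).
  move=> t01.
  have h1 := is_derive1_comp (is_derive1_ln (A0 _ t01)) (dA _ c t).
  have := is_deriveM h1 (is_derive_cst k^-1 t 1).
  move=> /is_derive_eq; apply; rewrite /GRing.scale /=; field.
  by rewrite !gt_eqF// A0.
have va : v 0 = a by rewrite /v /A mul0r addr0 expRK mulrC mulKf// gt_eqF.
have vb : v 1 = b.
  by rewrite /v /A /c mul1r addrC subrK expRK mulrC mulKf// gt_eqF.
exists v; rewrite -va -vb.
apply: (@classical_solutionI _ v (fun t => c / (k * A t)) a01).
- apply: derivable_within_continuous => s; rewrite in_itv/= => s01.
  by have [] := dv _ s01.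
- by move=> t /andP[t0 t1]; apply: dv; rewrite !ltW.
- move=> t /andP[t0 t1]; have At : 0 < A t by rewrite A0// !ltW.
  have h2 := is_deriveZ k (dA (expR (k * a)) c t).
  have kA : (k \*: (A : R -> R)) t != 0 by rewrite /= gt_eqF// mulr_gt0.
  have := is_deriveM (is_derive_cst c t 1) (is_deriveV kA h2).
  move=> /is_derive_eq; apply; rewrite /GRing.scale /= -/k -/(A t).
  rewrite -[k *: A t]/(k * A t); field.
  by rewrite !gt_eqF.
Qed.

End alpha_mean.

(** * Finite-dimensional convex geometry *)

Section row_vectors.
Context {R : realType} {N : nat}.
Local Notation V := 'rV[R]_N.
Implicit Types (u v w x y z : V) (K A : set V).

Lemma near_dist_lt x (r : R) : 0 < r -> \forall y \near x, `|y - x| < r.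
Proof.
by move=> r0; apply/nbhs_normP; exists r => // y /=; rewrite distrC.
Qed.

(** Near-covering compactness, with the right neighbourhoods of 0 as filter, makes local radii
    uniform. *)
Lemma compact_uniform K (P : R -> V -> Prop) : compact K ->
  (forall x, K x -> exists2 r, 0 < r &
    forall y d, K y -> `|y - x| < r -> 0 < d < r -> P d y) ->
  exists2 r, 0 < r & forall d y, 0 < d < r -> K y -> P d y.
Proof.
move=> /compact_near_coveringP cK h.
have [] := cK R (0^'+) (fun d y => K y -> P d y) _.
  move=> x Kx; have [r r0 hr] := h x Kx.
  near=> y d.
  have yr : `|y - x| < r.
    by near: y; exact: near_dist_lt.
  have dr : 0 < d < r.
    by apply/andP; split; near: d; [exact: nbhs_right_gt|exact: nbhs_right_lt].
  by move=> Ky; exact: hr.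
move=> r /= r0 hr; exists r => // d y /andP[d0 dr] Ky.
by apply: (hr d) => //=; rewrite sub0r normrN gtr0_norm.
Unshelve. all: by end_near. Qed.

(** * The Euclidean inner product and separation of a point from a convex set *)

Definition dot u v : R := \sum_i u 0 i * v 0 i.

Lemma dotC u v : dot u v = dot v u.
Proof. by apply: eq_bigr => i _; rewrite mulrC. Qed.

Lemma dotDr u v w : dot u (v + w) = dot u v + dot u w.
Proof. by rewrite -big_split; apply: eq_bigr => i _; rewrite mxE mulrDr. Qed.

Lemma dotZr u c v : dot u (c *: v) = c * dot u v.
Proof. by rewrite mulr_sumr; apply: eq_bigr => i _; rewrite mxE mulrCA. Qed.

Lemma dotBr u v w : dot u (v - w) = dot u v - dot u w.
Proof. by rewrite dotDr -scaleN1r dotZr mulN1r. Qed.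

Lemma dotDl u v w : dot (u + v) w = dot u w + dot v w.
Proof. by rewrite dotC dotDr !(dotC w). Qed.

Lemma dotZl u c v : dot (c *: u) v = c * dot u v.
Proof. by rewrite dotC dotZr dotC. Qed.

Lemma dotvv_ge0 u : 0 <= dot u u.
Proof. by apply: sumr_ge0 => i _; rewrite -expr2 sqr_ge0. Qed.

Lemma dotvv_eq0 u : dot u u = 0 -> u = 0.
Proof.
move=> /eqP; rewrite psumr_eq0 => [/allP h|i _]; last first.
  by rewrite -expr2 sqr_ge0.
apply/rowP => i; have := h i; rewrite mem_index_enum => /(_ isT)/=.
by rewrite mulf_eq0 orbb mxE => /eqP.
Qed.

Lemma ler_coord_norm u i : `|u 0 i| <= `|u|.
Proof.
rewrite [leRHS]/Num.norm /= mx_normrE; apply/bigmax_geP; right.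
by exists (0, i).
Qed.

(** The norm of row vectors is the sup norm, whence the factor [N] in this form of
    Cauchy-Schwarz. *)
Lemma ler_norm_dot u v : `|dot u v| <= N%:R * `|u| * `|v|.
Proof.
apply: le_trans (ler_norm_sum _ _ _) _.
apply: (@le_trans _ _ (\sum_(i < N) `|u| * `|v|)).
  by apply: ler_sum => i _; rewrite normrM ler_pM// ler_coord_norm.
by rewrite sumr_const card_ord -mulrA mulr_natl.
Qed.

Lemma dist2_continuous y : continuous (fun w => dot (w - y) (w - y)).
Proof.
have -> : (fun w => dot (w - y) (w - y)) =
    (fun w => \sum_(i < N) (w 0 i - y 0 i) ^+ 2).
  apply/funext => w; apply: eq_bigr => i _; rewrite !mxE//.
apply: continuous_big; first exact: add_continuous.
move=> i _ w.
have c : {for w, continuous (fun v : V => v 0 i - y 0 i)}.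
  by have c : {for w, continuous (fun v : V => v 0 i)};
    [exact: coord_continuous|exact: (cvgB c (cvg_cst _))].
exact: (cvgM c c).
Qed.

(** The last parameter at which the segment meets the closure exists by compactness; were its point
    interior, a later one would qualify. *)
Lemma frontier_segment A x y : closure A x -> ~ closure A y ->
  exists2 t, 0 <= t < 1 & frontier A (x + t *: (y - x)).
Proof.
move=> Ax Ay; pose p (t : R) := x + t *: (y - x).
have cp : continuous p.
  move=> t; apply: cvgD; first exact: cvg_cst.
  by apply: cvgZr_tmp; exact: cvg_id.
pose S := `[(0 : R), 1]%classic `&` p @^-1` closure A.
have cS : compact S.
  apply: compact_closedI; first exact: segment_compact.
  by apply: preimage_closed => [t _|]; [exact: cp|exact: closed_closure].
have S0 : S !=set0.
  by exists 0; split; rewrite /= ?in_itv/= ?lexx ?ler01// /p scale0r addr0.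
have cid : continuous (idfun : R -> R) by move=> s; exact: cvg_id.
have [t] := compact_EVT_max S0 cS (continuous_subspaceT cid).
move=> /set_mem[It At] tmax; have /andP[t0 t1] : 0 <= t <= 1.
  by move: It; clear; rewrite /= in_itv.
have tn1 : t < 1.
  rewrite lt_neqAle t1 andbT; apply/eqP => t1'; apply: Ay.
  have -> : y = p t by rewrite t1' /p scale1r addrC subrK.
  exact: At.
exists t; rewrite ?t0//; split=> // iA.
have hn : nbhs (p t) (closure A) by apply: filterS iA; exact: subset_closure.
have [r /= r0 hr] := (@nbhs_ballP R R t (p @^-1` closure A)).1 (cp t _ hn).
pose s := t + Num.min (r / 2) (1 - t).
have m0 : 0 < Num.min (r / 2) (1 - t) by rewrite lt_min divr_gt0// subr_gt0.
have m1 : Num.min (r / 2) (1 - t) <= 1 - t by rewrite ge_min lexx orbT.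
have m2 : Num.min (r / 2) (1 - t) <= r / 2 by rewrite ge_min lexx.
have : S s.
  split; first by rewrite /= in_itv/= /s; lra.
  by apply: (hr s); rewrite /ball /= /s opprD addNKr normrN gtr0_norm//; lra.
by move=> Ss; have := tmax s; rewrite inE => /(_ Ss); rewrite /s /=; lra.
Qed.

(* The functional is [y - p], where [p] is the point of [K] nearest to [y] *)
Lemma separating_functional K y : compact K -> K !=set0 -> ~ K y ->
  (forall u v (t : R), K u -> K v -> 0 <= t <= 1 ->
    K (t *: u + (1 - t) *: v)) ->
  exists2 nu, `|nu| = 1 & forall w, K w -> dot nu (w - y) <= 0.
Proof.
move=> cK K0 nKy convK.
have [p] := compact_EVT_min K0 cK
  (continuous_subspaceT (@dist2_continuous y)).
rewrite inE => Kp pmin; have [mu muE] : exists mu, mu = y - p by exists (y - p).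
have mu0 : mu != 0.
  rewrite muE subr_eq0; apply/eqP => yp; apply: nKy; rewrite yp; exact: Kp.
have hp w : K w -> dot mu (w - p) <= 0.
  move=> Kw; rewrite leNgt; apply/negP => c0; set c := dot mu (w - p) in c0.
  set q := dot (w - p) (w - p).
  have q0 : 0 <= q := dotvv_ge0 _.
  (* Minimality of [p] against the point at parameter [s] from [p] towards [w]. *)
  have H (s : R) : 0 <= s <= 1 -> 2 * s * c <= s ^+ 2 * q.
    move=> s01; have := pmin (s *: w + (1 - s) *: p).
    rewrite inE => /(_ (convK _ _ _ Kw Kp s01)).
    have -> : s *: w + (1 - s) *: p - y = s *: (w - p) - mu.
      by apply/rowP => i; rewrite muE !mxE; ring.
    have -> : p - y = - mu by rewrite muE opprB.
    rewrite /q /c; move: (w - p) => e.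
    by rewrite -(scaleN1r mu) !(dotDr, dotDl, dotZl, dotZr) (dotC e mu); lra.
  (* The choice [s = c / (c + q)] lies in [0, 1] and gives [s * q <= c < 2 * c], against [H]. *)
  have cq : 0 < c + q by rewrite ltr_pwDl.
  have s01 : 0 <= c / (c + q) <= 1.
    by rewrite divr_ge0 ?(ltW cq) ?(ltW c0)//= ler_pdivrMr// mul1r lerDl.
  have s0 : 0 < c / (c + q) by rewrite divr_gt0.
  have := H _ s01; set s := c / (c + q) in s01 s0 *.
  have sc : s * (c + q) = c by rewrite /s divfK// gt_eqF.
  nra.
have nmu : 0 < `|mu| by rewrite normr_gt0; exact: mu0.
exists (`|mu|^-1 *: mu); first by rewrite normrZ normfV normr_id mulVf// gt_eqF.
move=> w Kw; rewrite dotZl pmulr_rle0 ?invr_gt0//.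
have -> : w - y = (w - p) - mu by rewrite muE opprB addrA subrK.
by rewrite dotBr; have := hp _ Kw; have := dotvv_ge0 mu; lra.
Qed.

End row_vectors.

(** * Supporting functionals, chords and caps of a strictly convex domain *)

Section strictly_convex_domain.
Context {R : realType} {N : nat} (hN : (2 <= N)%N) (Omega : set 'rV[R]_N).
Context (hopen : open Omega) (hbnd : bounded_set Omega).
Context (hconv : strictly_convex Omega).
Local Notation V := 'rV[R]_N.
Implicit Types (u v w x y z nu d : V).

Lemma frontierE z : frontier Omega z <-> closure Omega z /\ ~ Omega z.
Proof. by rewrite /frontier (interior_id Omega).1. Qed.

Lemma frontier_closure z : frontier Omega z -> closure Omega z.
Proof. by case. Qed.

Lemma closure_bound : exists M : R, forall z, closure Omega z -> `|z| <= M.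
Proof.
have [M [_ hM]] := hbnd; exists (M + 1) => z Kz.
rewrite leNgt; apply/negP => zM.
have r0 : 0 < `|z| - (M + 1) by rewrite subr_gt0.
have [w [Ow /= wz]] := Kz _ (near_dist_lt z r0).
have wM : `|w| <= M + 1 by apply: (hM (M + 1) _ _ Ow); rewrite ltrDl.
have := ler_normD (z - w) w; rewrite subrK (distrC z); lra.
Qed.

Lemma closure_compact : compact (closure Omega).
Proof.
apply: bounded_closed_compact; last exact: closed_closure.
have [M hM] := closure_bound; exists M; split; first exact: num_real.
by move=> c Mc z Kz; apply: le_trans (hM _ Kz) (ltW Mc).
Qed.

Lemma frontier_compact : compact (frontier Omega).
Proof.
apply: compact_closedI; first exact: closure_compact.
by apply: open_closedC; exact: open_interior.
Qed.

Lemma closure_conv u v (t : R) : closure Omega u -> closure Omega v ->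
  0 <= t <= 1 -> closure Omega (t *: u + (1 - t) *: v).
Proof.
move=> Ku Kv /andP[t0 t1].
have [->|un] := eqVneq u v; first by rewrite -scalerDl addrC subrK scale1r.
have [->|t0'] := eqVneq t 0; first by rewrite scale0r add0r subr0 scale1r.
have [->|t1'] := eqVneq t 1; first by rewrite subrr scale0r addr0 scale1r.
apply/subset_closure/hconv => //; first exact/eqP.
by rewrite !lt_neqAle eq_sym t0' t0 t1' t1.
Qed.

Lemma delta_neq0 (i : 'I_N) : delta_mx 0 i != 0 :> V.
Proof.
apply/eqP => /rowP /(_ i); rewrite !mxE !eqxx /= => /eqP.
by rewrite oner_eq0.
Qed.

Lemma dot_delta nu (i : 'I_N) : dot nu (delta_mx 0 i) = nu 0 i.
Proof.
rewrite /dot (bigD1 i)//= big1 => [|j ji].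
  by rewrite mxE !eqxx mulr1 addr0.
by rewrite mxE (negbTE ji) andbF mulr0.
Qed.

(** Dimension at least two enters here: in general [d] is, up to sign, a quarter turn of the
    projection of [nu] to the first two coordinates. *)
Lemma exists_orthogonal nu : exists2 d, d != 0 & dot nu d = 0.
Proof.
pose i : 'I_N := Ordinal (ltnW hN); pose j : 'I_N := Ordinal hN.
have [ni|ni] := eqVneq (nu 0 i) 0.
  by exists (delta_mx 0 i); rewrite ?delta_neq0// dot_delta.
exists (nu 0 j *: delta_mx 0 i - nu 0 i *: delta_mx 0 j).
  apply/eqP => /rowP /(_ j); rewrite !mxE /= mulr0 mulr1 sub0r => /eqP.
  by rewrite oppr_eq0 (negbTE ni).
by rewrite dotBr !dotZr !dot_delta mulrC subrr.
Qed.

(** Were a ball around [z] inside the closure, [z] would be the midpoint of two distinct points of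
    the closure, hence in [Omega] by strict convexity. *)
Lemma frontier_approx z (r : R) : frontier Omega z -> 0 < r ->
  exists2 y, `|y - z| < r & ~ closure Omega y.
Proof.
move=> /frontierE[Kz nOz] r0; apply: contrapT => /forall2NP h.
have hK y : `|y - z| < r -> closure Omega y.
  by move=> yr; case: (h y) => // /contrapT.
pose e : V := delta_mx 0 (Ordinal (ltnW hN)).
have e0 : 0 < `|e| by rewrite normr_gt0 delta_neq0.
pose s := r / 2 / `|e|.
have se : `|s *: e| < r.
  by rewrite normrZ gtr0_norm ?divr_gt0// divfK ?gt_eqF//; lra.
have s0 : s != 0 by rewrite gt_eqF// !divr_gt0.
apply: nOz.
have -> : z = 2^-1 *: (z + s *: e) + (1 - 2^-1) *: (z - s *: e).
  by apply/rowP => i; rewrite !mxE; field.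
apply: hconv.
- by apply: hK; rewrite addrC addKr.
- by apply: hK; rewrite addrC addKr normrN.
- move=> /addrI /eqP; rewrite -subr_eq0 opprK -scalerDl scaler_eq0.
  rewrite -mulr2n mulrn_eq0/= (negbTE s0) /= => /eqP e0'.
  by move: e0; rewrite e0' normr0 ltxx.
- lra.
Qed.

(** If every unit functional failed at [z], compactness of the unit sphere would make all of them
    fail by a uniform amount; a functional separating a nearby outside point fails by less. *)
Lemma weak_supporting_functional z : frontier Omega z ->
  exists2 nu, `|nu| = 1 & forall w, closure Omega w -> dot nu (w - z) <= 0.
Proof.
move=> Fz; apply: contrapT => /forall2NP h.
have cS : compact [set nu : V | `|nu| = 1].
  apply: bounded_closed_compact.
    exists 1; split; first exact: num_real.
    by move=> c c1 nu /= ->; exact: ltW.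
  have -> : [set nu : V | `|nu| = 1] = Num.norm @^-1` [set 1] by [].
  apply: preimage_closed; last exact: closed_eq.
  by move=> nu _; exact: norm_continuous.
pose P c nu := exists2 w, closure Omega w & c <= dot nu (w - z).
have [r r0 hr] : exists2 r, 0 < r &
    forall c nu, 0 < c < r -> `|nu| = 1 -> P c nu.
  apply: (compact_uniform cS) => nu nu1.
  case: (h nu) => // /existsNP[w /not_implyP[Kw /negP]].
  rewrite -ltNge => c0; set c := dot _ _ in c0.
  have C0 : 0 < N%:R * `|w - z| + 1 by rewrite ltr_wpDl// mulr_ge0.
  (* Within this radius of [nu], the same [w] still gives a value above [e]. *)
  exists (c / (N%:R * `|w - z| + 1)); first exact: divr_gt0.
  move=> nu' e _ hnu /andP[e0 he]; exists w => //.
  have -> : dot nu' (w - z) = c + dot (w - z) (nu' - nu).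
    by rewrite (dotBr (w - z)) !(dotC (w - z)) -/c [RHS]addrC subrK.
  have := ler_norm_dot (w - z) (nu' - nu); rewrite ler_norml => /andP[l _].
  have n0 : 0 <= N%:R * `|w - z| by rewrite mulr_ge0.
  rewrite !ltr_pdivlMr// in hnu he; nra.
have C0 : 0 < N%:R + 1 :> R by rewrite ltr_wpDl.
have [y yz Ky] := frontier_approx Fz (divr_gt0 (divr_gt0 r0 (ltr0n _ 2)) C0).
have [nu nu1 hnu] := separating_functional closure_compact
  (ex_intro _ z (frontier_closure Fz)) Ky closure_conv.
have r2 : 0 < r / 2 < r by lra.
have [w Kw] := hr _ _ r2 nu1; apply/negP; rewrite -ltNge.
have -> : w - z = (w - y) + (y - z) by rewrite addrA subrK.
rewrite dotDr; have := hnu _ Kw; have := ler_norm_dot nu (y - z).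
rewrite nu1 mulr1 ler_norml => /andP[_ l].
by rewrite ltr_pdivlMr// in yz; have := normr_ge0 (y - z); nra.
Qed.

(** If another [w] lay on the supporting hyperplane, its midpoint with [z] would be in the open set
    [Omega] and could be pushed along [nu] across the hyperplane. *)
Lemma supporting_functional z : frontier Omega z ->
  exists nu, forall w, closure Omega w -> w != z -> dot nu (w - z) < 0.
Proof.
move=> Fz; have [nu nu1 hnu] := weak_supporting_functional Fz.
exists nu => w Kw wz; rewrite lt_neqAle hnu// andbT; apply/eqP => w0.
pose m := 2^-1 *: w + (1 - 2^-1) *: z.
have Om : Omega m.
  by apply: hconv => //; [exact: frontier_closure|exact/eqP|lra].
have /nbhs_normP[r /= r0 hr] : nbhs m Omega by exact: open_nbhs_nbhs.
have nn : 0 < dot nu nu.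
  rewrite lt_neqAle dotvv_ge0 andbT eq_sym; apply/eqP => /dotvv_eq0 n0.
  by move: nu1 => /eqP; rewrite n0 normr0 eq_sym oner_eq0.
have : Omega (m + (r / 2) *: nu).
  apply: hr => /=; rewrite opprD addNKr normrN normrZ nu1 mulr1 gtr0_norm; lra.
move=> /subset_closure /hnu.
have -> : m + (r / 2) *: nu - z = 2^-1 *: (w - z) + (r / 2) *: nu.
  by apply/rowP => i; rewrite !mxE; field.
by rewrite dotDr !dotZr w0 mulr0 add0r leNgt mulr_gt0// divr_gt0.
Qed.

Lemma exists_exit w d : closure Omega w -> d != 0 ->
  exists2 t, 0 <= t & frontier Omega (w + t *: d).
Proof.
move=> Kw d0; have [M hM] := closure_bound.
have nd : 0 < `|d| by rewrite normr_gt0.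
(* At this parameter the norm is at least [M + 1], so the ray has left the closure. *)
pose s := (M + `|w| + 1) / `|d|.
have M0 : 0 <= M := le_trans (normr_ge0 _) (hM _ Kw).
have s0 : 0 < s by rewrite divr_gt0// ltr_wpDl// addr_ge0.
have [|t /andP[t0 _]] := frontier_segment (y := w + s *: d) Kw.
  move=> /hM; apply/negP; rewrite -ltNge.
  have := ler_normB (w + s *: d) w; rewrite addrC addKr normrZ gtr0_norm//.
  by rewrite /s divfK ?gt_eqF// addrC; lra.
rewrite (addrC w (s *: d)) addrK scalerA => Ft.
by exists (t * s) => //; rewrite mulr_ge0// ltW.
Qed.

(** Leave the domain in both senses along a direction orthogonal to [nu]; if both exits are
    immediate, [w] is itself on the frontier. *)
Lemma exists_chord nu w : closure Omega w -> exists a b (t : R),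
  [/\ frontier Omega a, frontier Omega b, 0 <= t <= 1,
      w = t *: a + (1 - t) *: b & dot nu a = dot nu w /\ dot nu b = dot nu w].
Proof.
move=> Kw; have [d d0 nud] := exists_orthogonal nu.
have [t t0 Ft] := exists_exit Kw d0.
have [|s s0] := @exists_exit w (- d) Kw; first by rewrite oppr_eq0.
rewrite scalerN => Fs.
have [ts0|ts] := eqVneq (t + s) 0.
  have t00 : t = 0 by lra.
  rewrite t00 scale0r addr0 in Ft.
  exists w, w, 1; split=> //; first by lra.
  by rewrite subrr scale0r scale1r addr0.
have ts1 : 0 < t + s by rewrite lt_neqAle eq_sym ts addr_ge0.
exists (w + t *: d), (w - s *: d), (s / (t + s)); split=> //.
- by rewrite divr_ge0 ?(ltW ts1)//= ler_pdivrMr// mul1r lerDr.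
- by apply/rowP => i; rewrite !mxE; field.
- by rewrite dotBr dotDr !dotZr nud !mulr0 addr0 subr0.
Qed.

(** Away from [z] the functional is negative, locally bounded away from 0, so by compactness thin
    caps avoid all far points. *)
Lemma thin_cap z nu (r : R) :
  (forall w, closure Omega w -> w != z -> dot nu (w - z) < 0) -> 0 < r ->
  exists2 e, 0 < e & forall w, closure Omega w ->
    - e < dot nu (w - z) -> `|w - z| < r.
Proof.
move=> hnu r0.
have [e e0 he] : exists2 e, 0 < e & forall c w, 0 < c < e -> closure Omega w ->
    - c < dot nu (w - z) -> `|w - z| < r.
  apply: (@compact_uniform _ _ _ (fun c w => - c < dot nu (w - z) -> _)).
    exact: closure_compact.
  move=> x Kx; have [->|xz] := eqVneq x z; first by exists r.
  have c0 := hnu _ Kx xz; set c := dot _ _ in c0.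
  have C0 : 0 < N%:R * `|nu| + 1 by rewrite ltr_wpDl// mulr_ge0.
  exists (- c / (N%:R * `|nu| + 1)); first by rewrite divr_gt0// oppr_gt0.
  move=> w e _ hw /andP[e0 he]; have -> : w - z = (w - x) + (x - z).
    by rewrite addrA subrK.
  rewrite dotDr -/c => ec.
  have := ler_norm_dot nu (w - x); rewrite ler_norml => /andP[_ l].
  have n0 : 0 <= N%:R * `|nu| by rewrite mulr_ge0.
  exfalso; rewrite !ltr_pdivlMr// in hw he; nra.
exists (e / 2) => [|w Kw]; first by rewrite divr_gt0.
by apply: he => //; lra.
Qed.

End strictly_convex_domain.

(** * Envelopes *)

(** Existence and uniqueness of solutions replace the differential equation by a formula; the added
    parameters 0 and 1 hold automatically. *)
Lemma alpha_convexP (R : realType) (N : nat) (Omega : set 'rV[R]_N) (alpha : R)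
    (u : 'rV[R]_N -> R) : 0 <= alpha <= 1 ->
  alpha_convex Omega alpha u <->
  forall x y (t : R), closure Omega x -> closure Omega y -> 0 <= t <= 1 ->
    u (t *: x + (1 - t) *: y) <= alpha_mean alpha t (u y) (u x).
Proof.
move=> a01; split=> [h x y t Kx Ky /andP[t0 t1]|h x y Kx Ky v vs t t01].
  have [->|tn0] := eqVneq t 0.
    by rewrite scale0r add0r subr0 scale1r alpha_mean0.
  have [->|tn1] := eqVneq t 1.
    by rewrite scale1r subrr scale0r addr0 alpha_mean1.
  have t01 : 0 < t < 1 by rewrite !lt_neqAle eq_sym tn0 t0 tn1 t1.
  have [v vs] := exists_solution (u y) (u x) a01.
  by rewrite -(solution_alpha_mean a01 vs t01); exact: (h _ _ Kx Ky _ vs).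
rewrite (solution_alpha_mean a01 vs t01); case/andP: t01 => t0 t1.
by apply: h => //; rewrite !ltW.
Qed.

Section envelope.
Context {R : realType} {N : nat} (hN : (2 <= N)%N) (Omega : set 'rV[R]_N).
Context (hopen : open Omega) (hbnd : bounded_set Omega).
Context (hconv : strictly_convex Omega).
Context (g : 'rV[R]_N -> R) (hg : {within frontier Omega, continuous g}).
Local Notation V := 'rV[R]_N.
Local Notation u_ := (alpha_envelope Omega g).
Implicit Types (v : V -> R) (w x y z h : V) (alpha e : R).

Definition admissible alpha v :=
  alpha_convex Omega alpha v /\ forall x, frontier Omega x -> v x <= g x.

Lemma frontier_continuous z e : frontier Omega z -> 0 < e ->
  exists2 r, 0 < r &
    forall x, frontier Omega x -> `|x - z| < r -> `|g x - g z| < e.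
Proof.
move=> Fz e0.
have cz : g @ within (frontier Omega) (nbhs z) --> g z.
  by move/subspace_continuousP: hg => /(_ z Fz).
have /(_ _ e e0) := (@cvgrPdist_lt R R _ _ _ g (g z)).1 cz.
rewrite near_withinE => /nbhs_normP[r /= r0 hr].
exists r => // x Fx xz; rewrite distrC; apply: hr => //=.
by rewrite distrC.
Qed.

Lemma frontier_bounded :
  exists2 M, 0 < M & forall x, frontier Omega x -> `|g x| <= M.
Proof.
have /compact_bounded[M [_ hM]] :=
  continuous_compact hg (frontier_compact hbnd).
exists (`|M| + 1) => [|x Fx]; first by rewrite ltr_wpDl.
by apply: (hM (`|M| + 1)); [have := ler_norm M; lra|exists x].
Qed.

Lemma affine_alpha_convex alpha (c k : R) nu z : 0 <= alpha <= 1 ->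
  alpha_convex Omega alpha (fun x => c + k * dot nu (x - z)).
Proof.
move=> a01; apply/(alpha_convexP _ _ a01) => x y t _ _ t01.
apply: le_trans (conv_le_alpha_mean _ _ a01 t01).
have -> : t *: x + (1 - t) *: y - z = t *: (x - z) + (1 - t) *: (y - z).
  by apply/rowP => i; rewrite !mxE; ring.
rewrite le_eqVlt; apply/orP; left; apply/eqP.
by rewrite (dotDr nu (t *: (x - z))) !dotZr; ring.
Qed.

(** Quasiconvexity along a chord; its endpoints are fixed before [alpha] and [v], which is the
    source of uniformity in [alpha]. *)
Lemma admissible_le_chord nu w : closure Omega w ->
  exists a b, [/\ frontier Omega a, frontier Omega b,
    dot nu a = dot nu w, dot nu b = dot nu w & forall alpha v,
      0 <= alpha <= 1 -> admissible alpha v -> v w <= Num.max (g a) (g b)].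
Proof.
move=> Kw.
have [a [b [t [Fa Fb t01 wE [na nb]]]]] := exists_chord hN hbnd nu Kw.
exists a, b; split=> // alpha v a01 [/(alpha_convexP _ _ a01) cv vg].
rewrite wE; apply: le_trans (cv _ _ _ _ _ t01) _; try exact: frontier_closure.
apply: le_trans (alpha_mean_le_max _ _ a01 t01) _.
by rewrite ge_max !le_max !vg// orbT.
Qed.

Lemma exists_admissible alpha : 0 <= alpha <= 1 -> exists v, admissible alpha v.
Proof.
move=> a01; have [M _ hM] := frontier_bounded.
(* The constant [- M], written as an affine function of slope zero. *)
exists (fun x => - M + 0 * dot 0 (x - 0)); split.
  exact: affine_alpha_convex.
by move=> x /hM; rewrite mul0r addr0 ler_norml => /andP[].
Qed.

Lemma envelope_le alpha w (B : R) : 0 <= alpha <= 1 ->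
  (forall v, admissible alpha v -> v w <= B) -> u_ alpha w <= B.
Proof.
move=> a01 hB; apply: ge_sup => [|_ [v av <-]]; last exact: hB.
by have [v av] := exists_admissible a01; exists (v w), v.
Qed.

Lemma envelope_ge alpha v w : 0 <= alpha <= 1 -> closure Omega w ->
  admissible alpha v -> v w <= u_ alpha w.
Proof.
move=> a01 Kw av; apply: ub_le_sup; last by exists v.
(* Any chord through [w] bounds the competitors, so the functional may be 0. *)
have [a [b [_ _ _ _ hB]]] := admissible_le_chord 0 Kw.
by exists (Num.max (g a) (g b)) => _ [v' av' <-]; exact: (hB _ _ a01 av').
Qed.

(** Monotonicity of the mean passes alpha-convexity to suprema, so the envelope is the largest
    competitor. *)
Lemma envelope_admissible alpha : 0 <= alpha <= 1 ->
  admissible alpha (u_ alpha).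
Proof.
move=> a01; split=> [|x Fx]; last by apply: envelope_le => // v [_]; exact.
apply/(alpha_convexP _ _ a01) => x y t Kx Ky t01.
apply: envelope_le => // v av.
apply: le_trans ((alpha_convexP _ _ a01).1 av.1 _ _ _ Kx Ky t01) _.
by apply: le_alpha_mean2 => //; exact: envelope_ge.
Qed.

(** * Continuity of the envelopes at the boundary, uniformly in [alpha] *)

Lemma lower_barrier nu z e : frontier Omega z ->
  (forall w, closure Omega w -> w != z -> dot nu (w - z) < 0) -> 0 < e ->
  exists2 k, 0 < k &
    forall x, frontier Omega x -> g z - e + k * dot nu (x - z) <= g x.
Proof.
move=> Fz hnu e0; have [M M0 hM] := frontier_bounded.
have [r r0 hr] := frontier_continuous Fz e0.
have [s s0 hs] := thin_cap hbnd hnu r0.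
(* Outside the cap this slope lowers the barrier by at least [2 * M], a bound on the oscillation of
   [g]; inside, continuity of [g] suffices. *)
exists (2 * M / s) => [|x Fx]; first by rewrite divr_gt0// mulr_gt0.
have := hM _ Fx; have := hM _ Fz.
rewrite !ler_norml => /andP[z1 z2] /andP[x1 x2].
have k0 : 0 < 2 * M / s by rewrite divr_gt0// mulr_gt0.
have Kx := frontier_closure Fx.
have [xs|xs] := ltP (- s) (dot nu (x - z)).
  have := hr _ Fx (hs _ Kx xs); rewrite ltr_norml => /andP[gx _].
  have : dot nu (x - z) <= 0.
    have [->|xz] := eqVneq x z; last exact/ltW/hnu.
    by rewrite subrr -(scale0r z) dotZr mul0r.
  by move=> d0; have := mulr_ge0_le0 (ltW k0) d0; lra.
have : 2 * M / s * dot nu (x - z) <= 2 * M / s * - s by rewrite ler_pM2l.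
by rewrite mulrN divfK ?gt_eqF//; lra.
Qed.

Lemma envelope_near_frontier z e : frontier Omega z -> 0 < e ->
  exists2 r, 0 < r & forall alpha w, 0 <= alpha <= 1 -> closure Omega w ->
    `|w - z| < r -> `|u_ alpha w - g z| <= e.
Proof.
move=> Fz e0; have [nu hnu] := supporting_functional hN hopen hbnd hconv Fz.
have e20 : 0 < e / 2 by rewrite divr_gt0.
have [k k0 hk] := lower_barrier Fz hnu e20.
have [r r0 hr] := frontier_continuous Fz e0.
have [s s0 hs] := thin_cap hbnd hnu r0.
have C0 : 0 < N%:R * `|nu| + 1 by rewrite ltr_wpDl// mulr_ge0.
(* The bound [s] keeps the ends of the chord through [w] close to [z]; the bound [e / 2 / k] limits
   the loss in the barrier to [e / 2]. *)
pose m := Num.min s (e / 2 / k).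
have m0 : 0 < m by rewrite lt_min s0 divr_gt0.
exists (m / (N%:R * `|nu| + 1)) => [|alpha w a01 Kw hw]; first exact: divr_gt0.
have dm : - m < dot nu (w - z).
  have := ler_norm_dot nu (w - z); rewrite ler_norml => /andP[l _].
  have n0 : 0 <= N%:R * `|nu| by rewrite mulr_ge0.
  by rewrite ltr_pdivlMr// in hw; have := normr_ge0 (w - z); nra.
have ms : m <= s by rewrite ge_min lexx.
have mk : m <= e / 2 / k by rewrite ge_min lexx orbT.
rewrite ler_distl; apply/andP; split.
  apply: (@le_trans _ _ (g z - e / 2 + k * dot nu (w - z))); last first.
    apply: (envelope_ge (v := fun w => g z - e / 2 + k * dot nu (w - z))) => //.
    by split => //; exact: affine_alpha_convex.
  have : k * - m < k * dot nu (w - z) by rewrite ltr_pM2l.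
  have : m * k <= e / 2 by rewrite -ler_pdivlMr.
  by lra.
apply: envelope_le => // v av.
have [a [b [Fa Fb na nb hB]]] := admissible_le_chord nu Kw.
apply: le_trans (hB _ _ a01 av) _.
have H c : frontier Omega c -> dot nu c = dot nu w -> g c <= g z + e.
  move=> Fc nc; have : `|c - z| < r.
    apply: hs; first exact: frontier_closure.
    by rewrite dotBr nc -dotBr; apply: le_lt_trans dm; rewrite lerN2.
  by move=> /(hr _ Fc); rewrite ltr_norml => /andP[_]; lra.
by rewrite ge_max !H.
Qed.

(** Both values are compared with [g z0] at a nearby frontier point [z0]; compactness of the
    frontier makes the radius uniform. *)
Lemma envelope_frontier_modulus e : 0 < e ->
  exists2 r, 0 < r & forall alpha z w, 0 <= alpha <= 1 ->
    frontier Omega z -> closure Omega w -> `|w - z| < r ->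
    u_ alpha w - e <= u_ alpha z <= u_ alpha w + e.
Proof.
move=> e0; have e20 : 0 < e / 2 by rewrite divr_gt0.
have [r r0 hr] : exists2 r, 0 < r & forall d z, 0 < d < r -> frontier Omega z ->
    forall alpha w, 0 <= alpha <= 1 -> closure Omega w -> `|w - z| < d ->
    u_ alpha w - e <= u_ alpha z <= u_ alpha w + e.
  apply: compact_uniform; first exact: frontier_compact.
  move=> z0 Fz0; have [r r0 hr] := envelope_near_frontier Fz0 e20.
  exists (r / 2) => [|z d Fz hz /andP[d0 dr] alpha w a01 Kw hw].
    by rewrite divr_gt0.
  have hz0 : `|z - z0| < r by lra.
  have hw0 : `|w - z0| < r.
    have -> : w - z0 = (w - z) + (z - z0) by rewrite addrA subrK.
    by apply: le_lt_trans (ler_normD _ _) _; lra.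
  have := hr _ _ a01 Kw hw0; have := hr _ _ a01 (frontier_closure Fz) hz0.
  rewrite !ler_norml; lra.
exists (r / 2) => [|alpha z w a01 Fz Kw hw]; first by rewrite divr_gt0.
by apply: (hr (r / 2)) => //; lra.
Qed.

(** * Propagation of the boundary modulus to the interior *)

Lemma translate_exit m y h : closure Omega (m + h) ->
  exists2 s : R, 0 <= s <= 1 & closure Omega (m + s *: (y - m) + h) /\
    (s = 1 \/ frontier Omega (m + s *: (y - m) + h)).
Proof.
move=> Km; have [Ky|Ky] := pselect (closure Omega (y + h)).
  exists 1; first by rewrite lexx ler01.
  by rewrite scale1r (addrC y) addNKr; split=> //; left.
have [s /andP[s0 s1]] := frontier_segment Km Ky.
have -> : m + h + s *: (y + h - (m + h)) = m + s *: (y - m) + h.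
  by apply/rowP => i; rewrite !mxE; ring.
move=> Fs; exists s; first by rewrite s0 ltW.
by split; [exact: frontier_closure|right].
Qed.

(** The difficulty is alpha-convexity of the glued function [U]: a segment may leave the set where
    the translated branch is defined. *)
Lemma envelope_translate alpha h e : 0 <= alpha <= 1 ->
  (forall z w, frontier Omega z -> closure Omega w -> `|w - z| <= `|h| ->
    u_ alpha w - e <= u_ alpha z <= u_ alpha w + e) ->
  forall x, closure Omega x -> closure Omega (x + h) ->
  u_ alpha (x + h) - e <= u_ alpha x.
Proof.
move=> a01 hmod; have [cu ug] := envelope_admissible a01.
move/(alpha_convexP _ _ a01) : cu => cu.
pose U x := if `[< closure Omega (x + h) >]
  then Num.max (u_ alpha x) (u_ alpha (x + h) - e) else u_ alpha x.
have uU x : u_ alpha x <= U x by rewrite /U; case: ifP; rewrite // le_max lexx.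
have hU x : closure Omega (x + h) -> u_ alpha (x + h) - e <= U x.
  by move=> Kx; rewrite /U asboolT// le_max lexx orbT.
suff aU : admissible alpha U.
  by move=> x Kx Kxh; apply: le_trans (hU _ Kxh) _; exact: envelope_ge.
(* At the edge of the overlap the modulus makes the translated branch the smaller one. *)
have Fh x : closure Omega x -> closure Omega (x + h) ->
    frontier Omega x \/ frontier Omega (x + h) ->
    u_ alpha (x + h) - e <= u_ alpha x.
  move=> Kx Kxh [Fx|Fx].
    have d1 : `|x + h - x| <= `|h| by rewrite (addrC x) addrK.
    by have /andP[] := hmod _ _ Fx Kxh d1.
  have d2 : `|x - (x + h)| <= `|h| by rewrite opprD addrA subrr add0r normrN.
  by have /andP[_] := hmod _ _ Fx Kx d2; lra.
split=> [|x Fx]; last first.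
  rewrite /U; case: asboolP => Kxh; last exact: ug.
  rewrite ge_max ug//=; apply: le_trans (ug _ Fx).
  by apply: Fh => //; [exact: frontier_closure|left].
apply/(alpha_convexP _ _ a01) => x y t Kx Ky t01.
pose gam (s : R) := s *: x + (1 - s) *: y.
pose mean s := alpha_mean alpha s (U y) (U x).
have Kgam s : 0 <= s <= 1 -> closure Omega (gam s).
  by move=> s01; exact: closure_conv.
have ugam s : 0 <= s <= 1 -> u_ alpha (gam s) <= mean s.
  move=> s01; apply: le_trans (cu _ _ _ Kx Ky s01) _.
  exact: le_alpha_mean2.
rewrite -/(gam t) -/(mean t) {1}/U; case: asboolP => Kth; last exact: ugam.
rewrite ge_max ugam//=; have /andP[t0 t1] := t01.
(* Admissible stopping parameters: an end of the segment, where [U] itself is the datum, or an exit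
   point of its translate, where [Fh] applies. *)
have stop s : 0 <= s <= 1 -> closure Omega (gam s + h) ->
    s = 0 \/ s = 1 \/ frontier Omega (gam s + h) ->
    u_ alpha (gam s + h) - e <= mean s.
  move=> s01 Ks [s0|[s1|Fs]].
  - apply: le_trans (hU _ Ks) _; rewrite s0 /gam scale0r add0r subr0 scale1r.
    exact: alpha_mean0.
  - apply: le_trans (hU _ Ks) _; rewrite s1 /gam scale1r subrr scale0r addr0.
    exact: alpha_mean1.
  - exact: le_trans (Fh _ (Kgam _ s01) Ks (or_intror Fs)) (ugam _ s01).
(* Stop on either side of [t]: [p] towards [y], then [q] towards [x]. *)
have [p [pt Kp hp]] : exists p, [/\ 0 <= p <= t, closure Omega (gam p + h) &
    u_ alpha (gam p + h) - e <= mean p].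
  have [s /andP[s0 s1] []] := translate_exit y Kth.
  have -> : gam t + s *: (y - gam t) = gam (t * (1 - s)).
    by apply/rowP => i; rewrite !mxE; ring.
  move=> Ks hs; have pt : 0 <= t * (1 - s) <= t by nra.
  exists (t * (1 - s)); split=> //; apply: stop => //; first by lra.
  by case: hs => [->|]; [left; rewrite subrr mulr0|right; right].
have [q [qt Kq hq]] : exists q, [/\ t <= q <= 1, closure Omega (gam q + h) &
    u_ alpha (gam q + h) - e <= mean q].
  have [s /andP[s0 s1] []] := translate_exit x Kth.
  have -> : gam t + s *: (x - gam t) = gam (t + s * (1 - t)).
    by apply/rowP => i; rewrite !mxE; ring.
  move=> Ks hs; have qt : t <= t + s * (1 - t) <= 1 by nra.
  exists (t + s * (1 - t)); split=> //; apply: stop => //; first by lra.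
  by case: hs => [->|]; right; [left; rewrite mul1r addrC subrK|right].
have [pqE|pq] := eqVneq p q.
  have tp : t = p by move: pt qt; rewrite -pqE; lra.
  by rewrite tp; exact: hp.
have pq0 : 0 < q - p by rewrite subr_gt0 lt_neqAle pq; lra.
pose r := (t - p) / (q - p).
have rE : r * (q - p) = t - p by rewrite /r divfK// gt_eqF.
have r01 : 0 <= r <= 1.
  by rewrite /r divr_ge0/= ?ler_pdivrMr ?mul1r ?(ltW pq0)//; lra.
have gamE : gam t + h = r *: (gam q + h) + (1 - r) *: (gam p + h).
  have -> : t = p + r * (q - p) by rewrite rE addrC subrK.
  by apply/rowP => i; rewrite !mxE; ring.
(* Alpha-convexity between the stopping points, then their bounds by [mean], then composition of
   means back to the parameter [t]. *)
have := cu _ _ _ Kq Kp r01; rewrite -gamE -(lerD2r (- e)).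
move=> /le_trans; apply; apply: le_trans (alpha_meanB _ _ _ a01 r01) _.
apply: le_trans (le_alpha_mean2 a01 r01 hp hq) _.
have p01 : 0 <= p <= 1 by lra.
have q01 : 0 <= q <= 1 by lra.
have := alpha_mean_comp (U y) (U x) a01 r01 p01 q01.
have -> : (1 - r) * p + r * q = t by rewrite -[RHS](subrK p) -rE; ring.
exact.
Qed.

End envelope.

(** * Equicontinuity for the subspace topology of the closure *)

Lemma near_subspace (T : topologicalType) (A : set T) (x : T) (P : set T) :
  P x -> (A x -> \forall y \near x, A y -> P y) -> nbhs (x : subspace A) P.
Proof.
by move=> Px h; case: (nbhs_subspaceP A x) => Ax; [exact: h|move=> y ->].
Qed.

Theorem theorem1p4 (R : realType) (N : nat) (hN : (2 <= N)%N)
  (Omega : set 'rV[R]_N)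
  (hdom : is_domain Omega) (hbnd : bounded_set Omega)
  (hconv : strictly_convex Omega)
  (g : 'rV[R]_N -> R) (hg : {within frontier Omega, continuous g}) :
  equicontinuous [set alpha : R | 0 <= alpha <= 1]
    (fun alpha => (alpha_envelope Omega g alpha : subspace (closure Omega) -> R)).
Proof.
have [hopen _ _] := hdom.
move=> x E entE.
have [e /= e0 heE] : exists2 e : R, 0 < e &
    forall a b : R, `|a - b| < e -> E (a, b).
  have := entE; rewrite -entourage_ballE => -[e /= e0 he].
  by exists e => // a b ab; apply: he.
have e20 : 0 < e / 2 by rewrite divr_gt0.
have [r r0 hr] := envelope_frontier_modulus hN hopen hbnd hconv hg e20.
(* Points outside the closure are isolated in the subspace topology, so only points of the closure
   need the estimate. *)
apply: near_subspace => [a _|Kx]; first by apply: heE; rewrite subrr normr0.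
apply: filterS (near_dist_lt x r0) => y yx Ky alpha a01.
apply: heE.
(* A one-sided bound by the translation [w - z]; exchanging the points gives the other side, and
   [e / 2] leaves room for strictness. *)
have mono z w : closure Omega z -> closure Omega w -> `|w - z| < r ->
    alpha_envelope Omega g alpha w - e / 2 <= alpha_envelope Omega g alpha z.
  move=> Kz Kw wz.
  have := @envelope_translate _ _ hN _ hbnd hconv _ hg alpha (w - z) (e / 2)
    a01.
  have -> : w = z + (w - z) by rewrite addrC subrK.
  rewrite [z + _ - z]addrC addKr; apply=> //; last by rewrite addrC subrK.
  by move=> z' w' Fz' Kw' zw; apply: hr => //; apply: le_lt_trans wz.
have := mono _ _ Kx Ky yx; have := mono _ _ Ky Kx; rewrite distrC => /(_ yx).
by rewrite ltr_norml; lra.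
Qed.
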